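(* Let $q$ be an odd prime power, let $a,b,c\in\mathbb F_{q^2}$ and $d\in\mathbb F_{q^2}\setminus\mathbb F_q$. Put $\gamma=a^2-ab+c$, $\delta=a-b+d$ and $\epsilon=a^q-a-b^q+b$. Then \[\frac{x^{q+1}+x^2+ax^q+bx+c}{x^q+x+d}\] is a permutation rational function of $\mathbb F_{q^2}$ if and only if $\gamma\in\{0,-\epsilon^2\}$, $\delta=0$ and $\epsilon\neq0$.
   Context: A rational function $f$ over a finite field $\mathbb F_Q$ is written uniquely as $f=e\,\frac{g}{h}$ with $g,h$ relatively prime monic polynomials over $\mathbb F_Q$ and $e\in\mathbb F_Q^*$. It defines a map on $\mathbb F_Q\cup\{\infty\}$: for $s\in\mathbb F_Q$, $f(s)=e\,g(s)/h(s)$ if $h(s)\neq0$ and $f(s)=\infty$ if $h(s)=0$; moreover $f(\infty)=\infty$ if $\deg g>\deg h$, $f(\infty)=e$ if $\deg g=\deg h$, and $f(\infty)=0$ if $\deg g<\deg h$. If this map is a permutation of $\mathbb F_Q\cup\{\infty\}$, then $f$ is called a permutation rational function of $\mathbb F_Q$. Here $Q=q^2$. (Since $d\notin\mathbb F_q$, the denominator $x^q+x+d$ has no zero in $\mathbb F_{q^2}$.) *)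

(* Defs.v *)
From mathcomp Require Import all_boot all_algebra.

Set Implicit Arguments.
Unset Strict Implicit.
Unset Printing Implicit Defensive.

Import GRing.Theory.
Local Open Scope ring_scope.

Definition ratfun_normal_form (F : finFieldType) (f : {fraction {poly F}})
    (e : F) (g h : {poly F}) : Prop :=
  [/\ e != 0, g \is monic, h \is monic, coprimep g h
    & f = tofrac (e *: g) / tofrac h].

(* [None] is the point at infinity. Since [g] and [h] are nonzero in a normal
   form, comparing sizes amounts to comparing degrees. *)
Definition ratfun_map (F : finFieldType) (e : F) (g h : {poly F})
    (s : option F) : option F :=
  match s with
  | Some s => if h.[s] != 0 then Some (e * g.[s] / h.[s]) else None
  | None => if (size h < size g)%N then None
            else if size g == size h then Some e
            else Some 0
  end.

(* The zero function has no normal form, hence is not a permutation rational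
   function. *)
Definition permutation_ratfun (F : finFieldType) (f : {fraction {poly F}}) :
    Prop :=
  exists e g h, ratfun_normal_form f e g h /\ bijective (ratfun_map e g h).

(* Main.v *)
Require Import Defs.
From mathcomp Require Import all_boot all_algebra all_field.
From mathcomp Require Import ring.

(** The denominator has no zero and smaller degree than the numerator, so
    infinity is the only point sent to infinity and the question is whether
    [s |-> N(s) / D(s)] is injective on the field of order [q ^ 2]
    ([permutation_ratfunP]).  Write [conj x = x ^+ q], [B = b - a] and let
    [t = x + conj x] be the trace of [x], an element of the subfield of order
    [q].  The map becomes
        x |-> ((x + a) (t + B) + gamma) / (t + d),
    which is affine in [x] on each line [t = constant] of the plane of order [q].

    An injective map of this kind sends the [q] parallel lines [t = constant] to
    pairwise disjoint lines, which are therefore parallel.  Hence the ratio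
    [(t + B) / (t + d)] has a constant direction over the subfield, and
    comparing a few values of [t] gives [B = d], that is [delta = 0]
    ([fiberwise_affine_pole]).

    With [B = d] the map is [x |-> x + a + gamma / (t + d)].  It is injective if
    and only if the map it induces on traces,
        phi(t) = t + gamma / (t + d) + conj gamma / (t + conj d),
    is injective on the subfield ([injective_pole_perturbation]).  A permutation
    phi of the subfield satisfies [sum phi(t) = sum t] and
    [sum phi(t) ^ 2 = sum t ^ 2].  The sums of [1 / (t + d)] and
    [1 / (t + d) ^ 2] over the subfield are [1 / eps] and [1 / eps ^ 2], where
    [eps = d - conj d]; so the first condition says [conj gamma = gamma] and the
    second one says [gamma (gamma + eps ^ 2) = 0]
    ([trace_map_injective_necessary]).

    For the converse with [gamma = - eps ^ 2], the quotient
    [(phi(t) - phi(u)) / (t - u)] has the numerator [(X - Y) (X + Y)] with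
    [conj X = X] and [conj Y = - Y], where [Y] is a nonzero constant times [t - u];
    such a product vanishes only for [t = u]
    ([trace_map_injective_sufficient]). *)

Set Implicit Arguments.
Unset Strict Implicit.
Unset Printing Implicit Defensive.

Import GRing.Theory.
Local Open Scope ring_scope.

(** * Permutation rational functions without finite poles *)

Section Reduction.
Variables (F : finFieldType) (N D : {poly F}).
Hypotheses (D_nz : forall s, D.[s] != 0) (ltDN : (size D < size N)%N).

Let D0 : D != 0.
Proof. by apply/eqP=> D0; have := D_nz 0; rewrite D0 horner0 eqxx. Qed.

Let N0 : N != 0.
Proof. by rewrite -size_poly_gt0 (leq_ltn_trans _ ltDN). Qed.

Lemma exists_ratfun_normal_form :
  exists e g h, ratfun_normal_form (tofrac N / tofrac D) e g h.
Proof.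
pose G := gcdp N D.
have G0 : G != 0 by rewrite gcdp_eq0 negb_and N0.
have eN : N %/ G * G = N by rewrite divpK ?dvdp_gcdl.
have eD : D %/ G * G = D by rewrite divpK ?dvdp_gcdr.
have cop : coprimep (N %/ G) (D %/ G) by rewrite coprimep_div_gcd ?N0.
have N1 : N %/ G != 0 by apply: contraNneq N0 => E; rewrite -eN E mul0r.
have D1 : D %/ G != 0 by apply: contraNneq D0 => E; rewrite -eD E mul0r.
move: eN eD cop N1 D1; move: (N %/ G) (D %/ G) => n m eN eD cop n0 m0.
have ln0 : lead_coef n != 0 by rewrite lead_coef_eq0.
have lm0 : lead_coef m != 0 by rewrite lead_coef_eq0.
exists (lead_coef n / lead_coef m), ((lead_coef n)^-1 *: n),
  ((lead_coef m)^-1 *: m); split.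
- by rewrite mulf_neq0 ?invr_eq0.
- by rewrite monicE lead_coefZ mulVf.
- by rewrite monicE lead_coefZ mulVf.
- by rewrite coprimepZl ?coprimepZr ?invr_eq0.
- rewrite -eN -eD !tofracM -mulf_div divff ?mulr1 ?tofrac_eq0 //.
  apply/eqP; rewrite eqr_div ?tofrac_eq0 ?scaler_eq0 ?invr_eq0 ?(negPf lm0) //.
  rewrite -!tofracM tofrac_eq scalerA mulrAC divff // mul1r.
  by rewrite -scalerAl -scalerAr mulrC.
Qed.

Lemma ratfun_normal_form_cross e g h :
  ratfun_normal_form (tofrac N / tofrac D) e g h -> N * h = D * (e *: g).
Proof.
case=> e0 mg mh _ /eqP.
rewrite eqr_div ?tofrac_eq0 ?(monic_neq0 mh) // -!tofracM tofrac_eq => /eqP ->.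
by rewrite mulrC.
Qed.

(** A normal form may have cancelled a common factor of [N] and [D], but its
    denominator [h] divides [D], hence has no zero either, and the inequality
    between degrees survives cancellation. *)
Lemma ratfun_mapE e g h s :
  ratfun_normal_form (tofrac N / tofrac D) e g h ->
  ratfun_map e g h s = omap (fun s => N.[s] / D.[s]) s.
Proof.
move=> nf; have cross := ratfun_normal_form_cross nf.
case: nf => e0 mg mh cop _.
case: s => [s|] /=.
  have dvdhD : h %| D.
    rewrite -(Gauss_dvdpl _ (_ : coprimep h g)) 1?coprimep_sym //.
    by rewrite -(dvdpZr _ _ e0) scalerAr -cross dvdp_mull.
  have hs : h.[s] != 0.
    apply: contra (D_nz s) => /eqP hs.
    by rewrite -(divpK dvdhD) hornerM hs mulr0.
  rewrite hs; congr Some; apply/eqP; rewrite eqr_div //.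
  have := congr1 (fun p => p.[s]) cross.
  by rewrite !hornerM hornerZ => ->; rewrite mulrC.
have [h0 g0] := (monic_neq0 mh, monic_neq0 mg).
have := congr1 (fun p : {poly F} => size p) cross.
rewrite !size_mul ?scaler_eq0 ?negb_or ?e0 // size_scale //.
move=> eq_sz; rewrite ifT // ltnNge; apply/negP=> le_gh.
move: eq_sz; apply/eqP.
rewrite gtn_eqF // -ltnS !prednK ?addn_gt0 ?size_poly_gt0 ?D0 ?N0 //.
by rewrite -addSn leq_add.
Qed.

Lemma permutation_ratfunP :
  permutation_ratfun (tofrac N / tofrac D)
  <-> injective (fun s => N.[s] / D.[s]).
Proof.
split=> [[e [g [h [nf bij]]]] s t eq_st | inj].
  suff [//] : Some s = Some t.
  apply: (bij_inj bij); rewrite !(ratfun_mapE _ nf) /=.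
  by congr Some.
have [e [g [h nf]]] := exists_ratfun_normal_form.
exists e, g, h; split=> //; apply: injF_bij => s t.
rewrite !(ratfun_mapE _ nf).
by case: s t => [s|] [t|] //= [/inj ->].
Qed.

End Reduction.

(** * Power sums over a finite field *)

Section PowerSums.
Variable K : finFieldType.

Lemma natr_card_finField : #|K|%:R = 0 :> K.
Proof.
have : \sum_(x : K) x = \sum_(x : K) (x + 1) by rewrite (reindex_inj (addIr 1)).
by rewrite big_split /= sumr_const -[LHS]addr0 => /addrI/esym.
Qed.

(** Multiplication by [y] permutes the field, so the sum is multiplied by
    [y ^+ i]; some nonzero [y] has [y ^+ i != 1], because ['X^i - 1] has too few
    roots. *)
Lemma sum_expr_finField i : (i < #|K|.-1)%N -> \sum_(x : K) x ^+ i = 0.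
Proof.
case: i => [_|i lti].
  rewrite (eq_bigr (fun=> 1)) => [|x _]; last by rewrite expr0.
  by rewrite sumr_const natr_card_finField.
have [y y0 yi] : exists2 y : K, y != 0 & y ^+ i.+1 != 1.
  case: (pickP (fun y : K => (y != 0) && (y ^+ i.+1 != 1))) => [y /andP[]|all1].
    by exists y.
  have P0 : 'X^(i.+1) - 1%:P != 0 :> {poly K}.
    by rewrite -size_poly_gt0 size_XnsubC.
  have /(max_poly_roots P0) : all (root ('X^(i.+1) - 1%:P)) (enum (predC1 (0 : K))).
    apply/allP=> y; rewrite mem_enum => y0.
    by rewrite rootE !hornerE subr_eq0; move: (all1 y); rewrite [y != 0]y0 => /negPn.
  rewrite enum_uniq -cardE cardC1 size_XnsubC // ltnS => /(_ isT).
  by rewrite leqNgt lti.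
have yU : y \is a GRing.unit by rewrite unitfE.
apply/eqP; move: yi; apply: contraR => S0; rewrite -(inj_eq (mulIf S0)) mul1r.
rewrite [X in _ == X](reindex_inj (mulrI yU)) mulr_sumr.
by apply/eqP/eq_bigr=> x _; rewrite exprMn.
Qed.

Lemma sum_expr_card_finField : \sum_(x : K) x ^+ #|K|.-1 = -1.
Proof.
rewrite (bigD1 0) //= expr0n -subn1 subn_eq0 leqNgt card_finNzRing_gt1 add0r.
rewrite (eq_bigr (fun=> 1)) => [|x x0]; last first.
  apply: (mulfI x0); rewrite mulr1 -exprS subn1 prednK ?expf_card //.
  exact: ltnW (card_finNzRing_gt1 K).
rewrite sumr_const cardC1 -subn1 natrB ?natr_card_finField ?sub0r //.
exact: ltnW (card_finNzRing_gt1 K).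
Qed.

Lemma sum_horner_finField (R : comNzRingType) (iota : {rmorphism K -> R})
    (p : {poly R}) :
  (size p <= #|K|)%N -> \sum_(x : K) p.[iota x] = - p`_(#|K|.-1).
Proof.
move=> szp.
under eq_bigr => x _ do rewrite (horner_coef_wide _ szp).
rewrite exchange_big /= -(prednK (ltnW (card_finNzRing_gt1 K))) big_ord_recr /=.
under eq_bigr => i _.
  rewrite -mulr_sumr; under eq_bigr => x _ do rewrite -rmorphXn.
  rewrite -rmorph_sum sum_expr_finField // rmorph0 mulr0; over.
rewrite big1_eq add0r -mulr_sumr; under eq_bigr => x _ do rewrite -rmorphXn.
by rewrite -rmorph_sum sum_expr_card_finField rmorphN1 mulrN1.
Qed.

Lemma sum_monic_horner (R : comNzRingType) (iota : {rmorphism K -> R})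
    (p : {poly R}) :
  p \is monic -> size p = #|K| -> \sum_x p.[iota x] = -1.
Proof.
move=> /monicP lc sz; rewrite sum_horner_finField ?sz //.
by rewrite -sz -lead_coefE lc.
Qed.

End PowerSums.

Lemma size_exp_XaddC (R : nzRingType) n (a : R) :
  size (('X + a%:P) ^+ n) = n.+1.
Proof. by rewrite -[a]opprK polyCN size_exp_XsubC. Qed.

(** * Quadratic extensions and their conjugation *)

Section QuadraticExtension.
Variables (K F : finFieldType) (iota : {rmorphism K -> F}).
Variable conj : {rmorphism F -> F}.
Hypotheses (cardF : #|F| = (#|K| ^ 2)%N) (conjE : forall x, conj x = x ^+ #|K|).
Hypothesis oddK : odd #|K|.

Lemma conjK : involutive conj.
Proof. by move=> x; rewrite !conjE -exprM mulnn -cardF expf_card. Qed.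

Lemma conj_trace x : conj (x + conj x) = x + conj x.
Proof. by rewrite rmorphD conjK addrC. Qed.

Lemma conj_iota t : conj (iota t) = iota t.
Proof. by rewrite conjE -rmorphXn expf_card. Qed.

(** The elements fixed by [conj] are the roots of ['X^#|K| - 'X], which splits
    over the subfield [K]. *)
Lemma conj_fixedP x : reflect (conj x = x) (x \in codom iota).
Proof.
apply: (iffP codomP) => [[t ->]|fix_x]; first exact: conj_iota.
have /(congr1 (fun p => (map_poly iota p).[x])) := finField_genPoly K.
rewrite rmorphB /= map_polyXn map_polyX !hornerE -conjE fix_x subrr.
rewrite rmorph_prod horner_prod => /esym/eqP/prodf_eq0 [t _].
rewrite rmorphB /= map_polyX map_polyC !hornerE subr_eq0 => /eqP ->.
by exists t.
Qed.

Definition fixed_injective (f : F -> F) :=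
  forall t u, conj t = t -> conj u = u -> f t = f u -> t = u.

Lemma two_neq0 : 2%:R != 0 :> F.
Proof.
apply/eqP=> two0; have /eqP := rmorph0 iota.
rewrite -(natr_card_finField K) rmorph_nat -(odd_double_half #|K|) oddK.
by rewrite -muln2 natrD natrM two0 mulr0 addr0 oner_eq0.
Qed.

(** The form in which injectivity on the subfield is used: an injective map of
    [K] to itself, seen in [F], has the same power sums as the identity. *)
Lemma sum_injective_power (f : K -> F) k :
  injective f -> (forall t, conj (f t) = f t) ->
  \sum_t f t ^+ k = iota (\sum_t t ^+ k).
Proof.
move=> inj_f fix_f.
have f_iota t : exists u, f t == iota u.
  by have /conj_fixedP/codomP[u ->] := fix_f t; exists u.
pose g t := xchoose (f_iota t).
have gE t : f t = iota (g t) by apply/eqP/(xchooseP (f_iota t)).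
have inj_g : injective g by move=> t u eq_g; apply: inj_f; rewrite !gE eq_g.
rewrite [in RHS](reindex_inj inj_g) rmorph_sum.
by apply: eq_bigr => t _; rewrite gE rmorphXn.
Qed.

Lemma trace_half_add d t r : conj t = t -> conj r = r ->
  let x := t / 2%:R + r * (d - conj d) in x + conj x = t.
Proof.
move=> fix_t fix_r; rewrite /= rmorphD fmorph_div rmorphM rmorphB conjK rmorph_nat.
by rewrite fix_t fix_r; field; rewrite two_neq0.
Qed.

(** * Sums of inverse powers of [t + d] *)

Section Poles.
Variable d : F.
Hypothesis d_notin : conj d != d.

Lemma subr_conj_neq0 : d - conj d != 0.
Proof. by rewrite subr_eq0 eq_sym. Qed.

Lemma fixed_addr_neq0 t : conj t = t -> t + d != 0.
Proof.
move=> fix_t; apply: contra d_notin; rewrite addr_eq0 => /eqP E.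
by rewrite -[d]opprK -E rmorphN fix_t.
Qed.

(** Since [(iota t + d) ^+ q] is the conjugate [iota t + conj d], the inverse
    [(iota t + d)^-1] is a polynomial in [iota t]; this turns the sums below into
    sums of values of polynomials of degree less than [q]. *)
Lemma expr_card_pred t : (iota t + d) ^+ #|K|.-1 = (iota t + conj d) / (iota t + d).
Proof.
have nz := fixed_addr_neq0 (conj_iota t).
apply: (mulIf nz); rewrite divfK // -exprSr prednK ?(ltnW (card_finNzRing_gt1 _)) //.
by rewrite -conjE rmorphD conj_iota.
Qed.

Lemma sum_inv : \sum_t (iota t + d)^-1 = (d - conj d)^-1.
Proof.
have e0 := subr_conj_neq0.
have term t : (iota t + d)^-1
    = (1 - (('X + d%:P) ^+ #|K|.-1).[iota t]) / (d - conj d).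
  have nz := fixed_addr_neq0 (conj_iota t).
  by rewrite !hornerE expr_card_pred; field; rewrite e0.
under eq_bigr => t _ do rewrite term.
rewrite -mulr_suml sumrB sumr_const.
rewrite -(rmorph_nat iota) natr_card_finField rmorph0 sum_monic_horner.
- by rewrite sub0r opprK mul1r.
- by rewrite monic_exp ?monicXaddC.
- by rewrite size_exp_XaddC prednK ?(ltnW (card_finNzRing_gt1 _)).
Qed.

Lemma sum_inv_sqr : \sum_t (iota t + d)^-1 ^+ 2 = (d - conj d)^-1 ^+ 2.
Proof.
have e0 := subr_conj_neq0.
have K_gt1 := card_finNzRing_gt1 K.
have K_gt0 := ltnW K_gt1.
pose y := ('X + d%:P) ^+ #|K|.-1.
pose z := ('X + (conj d)%:P) * ('X + d%:P) ^+ #|K|.-2.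
have term t : (iota t + d)^-1 ^+ 2
    = (1 - 2%:R * y.[iota t] + z.[iota t]) / (d - conj d) ^+ 2.
  have nz := fixed_addr_neq0 (conj_iota t).
  (* The square of [y] has degree [2 * (q - 1)]; [z] is a polynomial of degree
     [q - 1] with the same values on [K]. *)
  have -> : z.[iota t] = y.[iota t] ^+ 2.
    have predE : #|K|.-1 = #|K|.-2.+1 by case: #|K| K_gt1 => [|[]].
    rewrite !hornerE [in RHS]expr2 {1}expr_card_pred predE exprS.
    by field.
  by rewrite !hornerE expr_card_pred; field; rewrite nz e0.
under eq_bigr => t _ do rewrite term.
rewrite -mulr_suml big_split /= sumrB sumr_const -mulr_sumr.
rewrite -(rmorph_nat iota) natr_card_finField rmorph0 !sum_monic_horner.
- by field.
- by rewrite monicMl ?monic_exp ?monicXaddC.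
- rewrite size_monicM ?monicXaddC ?monic_neq0 ?monic_exp ?monicXaddC //.
  rewrite size_XaddC size_exp_XaddC add2n /=.
  by case: #|K| K_gt1 => [|[]].
- by rewrite monic_exp ?monicXaddC.
- by rewrite size_exp_XaddC prednK.
Qed.

End Poles.

(** * The map induced on traces *)

Section TraceMap.
Variables d g : F.
Hypothesis d_notin : conj d != d.

(** The trace of [x + g / (x + conj x + d)] as a function of the trace
    [t = x + conj x] of [x], see [trace_shift]. *)
Definition trace_map t := t + g / (t + d) + conj g / (t + conj d).

Lemma trace_map_fixed t : conj t = t -> conj (trace_map t) = trace_map t.
Proof.
move=> fix_t; rewrite /trace_map !rmorphD !fmorph_div !rmorphD !conjK fix_t.
by rewrite addrAC.
Qed.

Lemma fixed_conj_addr_neq0 t : conj t = t -> t + conj d != 0.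
Proof. by move=> fix_t; rewrite -[t]fix_t -rmorphD fmorph_eq0 fixed_addr_neq0. Qed.

Lemma trace_shift x :
  let f := x + g / (x + conj x + d) in f + conj f = trace_map (x + conj x).
Proof.
rewrite /trace_map rmorphD fmorph_div rmorphD conj_trace /=.
by rewrite addrACA addrA.
Qed.

(** Two points with the same image differ by a function of their traces.  If
    [trace_map] identifies [t] and [u], then moving a point of trace [t] by the
    difference of the two values of [g / (_ + d)] produces a point of trace [u]
    with the same image.  Conversely, points with the same image have traces
    identified by [trace_map], and once the traces agree so do the points. *)
Lemma injective_pole_perturbation a :
  injective (fun x => x + a + g / (x + conj x + d)) <-> fixed_injective trace_map.
Proof.
split=> [inj t u fix_t fix_u eq_tu | inj x y].
  have [x xE] : exists x, x + conj x = t.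
    exists (t / 2%:R); rewrite fmorph_div rmorph_nat fix_t.
    by field; rewrite two_neq0.
  pose y := x + g / (t + d) - g / (u + d).
  have yE : y + conj y = u.
    have -> : y + conj y = trace_map t - (trace_map u - u).
      rewrite /y rmorphB rmorphD /= !fmorph_div !rmorphD fix_t fix_u /trace_map.
      by rewrite -xE; ring.
    by rewrite eq_tu; ring.
  have exy : x = y by apply: inj; rewrite /= xE yE /y; ring.
  by rewrite -xE exy yE.
rewrite ![_ + a + _]addrAC => /addIr eq_xy.
have trE : x + conj x = y + conj y.
  by apply: inj; rewrite ?conj_trace // -!trace_shift eq_xy.
by move: eq_xy; rewrite trE => /addIr.
Qed.

(** In terms of [2 t + d + conj d] the map for [g = - (d - conj d) ^+ 2] is, up to
    affine changes, the cubic map [z (z ^ 2 - 9 e) / (z ^ 2 - e)] with the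
    [e = (d - conj d) ^+ 2], a nonsquare of the subfield; the numerator of its
    difference quotient factors over [F] as [(X - Y) (X + Y)]. *)
Lemma trace_map_injective_sufficient :
  g = 0 \/ g = - (d - conj d) ^+ 2 -> fixed_injective trace_map.
Proof.
case=> gE t u fix_t fix_u.
  by rewrite /trace_map gE rmorph0 !mul0r !addr0.
have e0 := subr_conj_neq0 d_notin.
have [td tD] := (fixed_addr_neq0 d_notin fix_t, fixed_conj_addr_neq0 fix_t).
have [ud uD] := (fixed_addr_neq0 d_notin fix_u, fixed_conj_addr_neq0 fix_u).
have gconj : conj g = g.
  by rewrite gE rmorphN rmorphXn rmorphB conjK -sqrrN opprB.
have n16 : 16%:R != 0 :> F by rewrite (natrX _ 2 4) expf_neq0 ?two_neq0.
rewrite /trace_map gconj gE => /eqP; rewrite -subr_eq0.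
pose X := (t *+ 2 + d + conj d) * (u *+ 2 + d + conj d) + (d - conj d) ^+ 2 *+ 3.
pose Y := (d - conj d) * (t - u) *+ 2.
have -> : t + - (d - conj d) ^+ 2 / (t + d) + - (d - conj d) ^+ 2 / (t + conj d) -
    (u + - (d - conj d) ^+ 2 / (u + d) + - (d - conj d) ^+ 2 / (u + conj d))
  = (t - u) * ((X - Y) * (X + Y))
     / ((t + d) * (t + conj d) * (u + d) * (u + conj d) *+ 16).
  by rewrite /X /Y; field; rewrite n16 td tD ud uD.
have Xconj : conj X = X.
  rewrite /X !(rmorphD, rmorphN, rmorphM, rmorphXn, rmorphMn) conjK.
  rewrite fix_t fix_u /=.
  by ring.
have Yconj : conj Y = - Y.
  rewrite /Y !(rmorphD, rmorphN, rmorphM, rmorphXn, rmorphMn) conjK.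
  rewrite fix_t fix_u /=.
  by ring.
have Y0 : Y = 0 -> t = u.
  rewrite /Y -mulr_natr => /eqP; rewrite !mulf_eq0 (negPf e0) (negPf two_neq0) orbF /=.
  by rewrite subr_eq0 => /eqP.
have dblY : Y = - Y -> t = u.
  move=> EY; apply/Y0/(mulIf two_neq0); rewrite mul0r mulr_natr mulr2n {1}EY.
  by rewrite addNr.
rewrite mulf_eq0 invr_eq0 => /orP[|]; last first.
  by rewrite -mulr_natr !mulf_eq0 (negPf td) (negPf tD) (negPf ud) (negPf uD) (negPf n16).
rewrite !mulf_eq0 !subr_eq0 addr_eq0 => /or3P[/eqP // | /eqP EX | /eqP EX].
  by apply: dblY; rewrite -Yconj -EX Xconj.
by apply: dblY; rewrite -Yconj -[Y]opprK -EX rmorphN Xconj.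
Qed.

(** Comparing the first power sums gives [conj g = g], comparing the second ones
    gives [g * (g + (d - conj d) ^+ 2) = 0]. *)
Lemma trace_map_injective_necessary :
  fixed_injective trace_map -> g = 0 \/ g = - (d - conj d) ^+ 2.
Proof.
move=> inj; have e0 := subr_conj_neq0 d_notin.
pose x t := (iota t + d)^-1; pose y t := (iota t + conj d)^-1.
have fE t : trace_map (iota t) = iota t + g * x t + conj g * y t by [].
have sum_x : \sum_t x t = (d - conj d)^-1 by rewrite (sum_inv d_notin).
have D_notin : conj (conj d) != conj d by rewrite conjK eq_sym.
have sum_y : \sum_t y t = - (d - conj d)^-1.
  by rewrite (sum_inv D_notin) conjK -opprB invrN.
have sum_x2 : \sum_t x t ^+ 2 = (d - conj d)^-1 ^+ 2 by rewrite (sum_inv_sqr d_notin).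
have sum_y2 : \sum_t y t ^+ 2 = (d - conj d)^-1 ^+ 2.
  by rewrite (sum_inv_sqr D_notin) conjK -opprB invrN sqrrN.
have power k : \sum_t trace_map (iota t) ^+ k = iota (\sum_t t ^+ k).
  apply: sum_injective_power => [t u eq_tu | t].
    by apply: (fmorph_inj iota); apply: inj; rewrite ?conj_iota.
  by rewrite trace_map_fixed ?conj_iota.
have gconj : conj g = g.
  have := power 1%N; under eq_bigr => t _ do rewrite expr1 fE.
  rewrite !big_split /= -!mulr_sumr sum_x sum_y rmorph_sum /=.
  under [in RHS]eq_bigr => t _ do rewrite expr1.
  rewrite -addrA -[RHS]addr0 => /addrI/eqP.
  by rewrite mulrN -mulrBl mulf_eq0 invr_eq0 (negPf e0) orbF subr_eq0 eq_sym => /eqP.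
(* The square, in partial fractions: [iota t * x t = 1 - d * x t], and [x t * y t]
   is [(y t - x t) / (d - conj d)]. *)
have term t : trace_map (iota t) ^+ 2 = iota t ^+ 2
    + (g * 2%:R) * (2%:R - d * x t - conj d * y t)
    + g ^+ 2 * (x t ^+ 2 + y t ^+ 2 + 2%:R / (d - conj d) * (y t - x t)).
  have td := fixed_addr_neq0 d_notin (conj_iota t).
  have tD := fixed_conj_addr_neq0 (conj_iota t).
  by rewrite fE gconj /x /y; field; rewrite td tD e0.
have := power 2%N; under eq_bigr => t _ do rewrite term.
rewrite rmorph_sum /=; under [in RHS]eq_bigr => t _ do rewrite rmorphXn.
rewrite !big_split /= -!mulr_sumr !big_split /= sumrN -!mulr_sumr !sumrN -!mulr_sumr.
rewrite big_split /= sumrN sum_x sum_y sum_x2 sum_y2.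
rewrite sumr_const -[in _ *+ #|_|]mulr_natr.
rewrite -(rmorph_nat iota #|K|) natr_card_finField rmorph0 mulr0.
rewrite -addrA -[RHS]addr0 => /addrI E.
have : g * (g + (d - conj d) ^+ 2) * 2%:R = 0.
  rewrite -[RHS](mulr0 (- (d - conj d) ^+ 2)) -[in RHS]E.
  by field.
move/eqP; rewrite !mulf_eq0 (negPf two_neq0) orbF addr_eq0.
by case/orP=> /eqP; [left | right].
Qed.

End TraceMap.

(** * Directions of the image lines *)

Section Directions.
Variables (a B g d : F).
Hypothesis d_notin : conj d != d.

Definition fiberwise_affine x := ((x + a) * (x + conj x + B) + g) / (x + conj x + d).

(** The points of trace [t] are the [t / 2 + r * (d - conj d)] with [r] in the
    subfield, and the image of this line has direction [M t].  If the directions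
    [M t] and [M u] were independent over the subfield, the image lines would
    meet, and the common point would have preimages of distinct traces [t] and
    [u].  The equation expresses that [M t] and [M u] are dependent. *)
Lemma fiberwise_affine_parallel t u :
  injective fiberwise_affine -> conj t = t -> conj u = u ->
  (t + B) * (t + conj d) * ((u + conj B) * (u + d))
  = (t + conj B) * (t + d) * ((u + B) * (u + conj d)).
Proof.
move=> inj fix_t fix_u; apply/eqP.
have [-> | ne_tu] := eqVneq t u; first by apply/eqP; ring.
apply: contraNT ne_tu; rewrite -subr_eq0 => P0.
have e0 := subr_conj_neq0 d_notin.
have [td tD] := (fixed_addr_neq0 d_notin fix_t, fixed_conj_addr_neq0 d_notin fix_t).
have [ud uD] := (fixed_addr_neq0 d_notin fix_u, fixed_conj_addr_neq0 d_notin fix_u).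
pose e := d - conj d; pose M v := (v + B) * e / (v + d).
pose b v := ((v / 2%:R + a) * (v + B) + g) / (v + d).
have lineE v r : conj v = v -> conj r = r ->
    fiberwise_affine (v / 2%:R + r * e) = b v + r * M v.
  move=> fix_v fix_r; rewrite /fiberwise_affine (trace_half_add d fix_v fix_r) /b /M /e.
  by rewrite [r * (_ / _)]mulrA -mulrDl; congr (_ / _); ring.
pose W := M t * conj (M u) - conj (M t) * M u.
have WE : W = - e ^+ 2 * ((t + B) * (t + conj d) * ((u + conj B) * (u + d)) -
    (t + conj B) * (t + d) * ((u + B) * (u + conj d)))
     / ((t + d) * (t + conj d) * ((u + d) * (u + conj d))).
  rewrite /W /M /e.
  rewrite !(fmorphV, rmorphM, rmorphD, rmorphN) !conjK fix_t fix_u /=.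
  by field; rewrite td tD ud uD.
have W0 : W != 0.
  by rewrite WE mulf_neq0 ?invr_eq0 ?mulf_neq0 ?oppr_eq0 ?expf_neq0.
have conjW : conj W = - W.
  by rewrite /W !(rmorphB, rmorphM) !conjK /= opprB; congr (_ - _); rewrite mulrC.
(* Cramer's rule for [r * M t - r' * M u = c] and the conjugate equation; both
   solutions are fixed because numerators and [W] are anti-invariant. *)
pose c := b u - b t.
pose r := (c * conj (M u) - conj c * M u) / W.
pose r' := (c * conj (M t) - conj c * M t) / W.
have fix_r : conj r = r.
  rewrite /r fmorph_div conjW rmorphB !rmorphM !conjK invrN mulrN -mulNr opprB.
  by congr (_ / _).
have fix_r' : conj r' = r'.
  rewrite /r' fmorph_div conjW rmorphB !rmorphM !conjK invrN mulrN -mulNr opprB.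
  by congr (_ / _).
have sol : r * M t - r' * M u = c.
  apply: (mulIf W0); rewrite mulrBl /r /r'.
  rewrite ![_ / W * _ * W]mulrAC !divfK // /W; ring.
have eq_f : fiberwise_affine (t / 2%:R + r * e) = fiberwise_affine (u / 2%:R + r' * e).
  rewrite !lineE //; apply/eqP; rewrite -subr_eq0 -(subrr c) -{1}sol /c.
  by apply/eqP; ring.
by rewrite -(trace_half_add d fix_t fix_r) (inj _ _ eq_f) (trace_half_add d fix_u fix_r').
Qed.

(** With [G t = (t + B) * (t + conj d)] and [H] its conjugate on the subfield,
    parallelism says [G t * H u = H t * G u].  The second difference at
    [t = -1, 0, 1] of the monic quadratics [G] and [H] is [2], so
    [G u = H u] for all [u]; then [B - d] is fixed by [conj], and [B * conj d]
    as well, which forces [B = d]. *)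
Lemma fiberwise_affine_pole : injective fiberwise_affine -> B = d.
Proof.
move=> inj; have e0 := subr_conj_neq0 d_notin.
pose G t := (t + B) * (t + conj d); pose H t := (t + conj B) * (t + d).
have GH u : conj u = u -> G u = H u.
  move=> fix_u; apply: (mulIf two_neq0).
  have par t (fix_t : conj t = t) : G t * H u = H t * G u.
    exact: fiberwise_affine_parallel.
  have p0 := par 0 (rmorph0 _); have p1 := par 1 (rmorph1 _).
  have pN := par (-1) (rmorphN1 _).
  have -> : G u * 2%:R = H 1 * G u + H (-1) * G u - (H 0 * G u) * 2%:R.
    by rewrite /H; ring.
  by rewrite -p0 -p1 -pN {1 2 3}/G; ring.
have := GH 0 (rmorph0 _); have := GH 1 (rmorph1 _).
rewrite /G /H => E1 E0.
have EB : conj B = B + conj d - d.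
  apply/eqP; rewrite -subr_eq0; apply/eqP.
  transitivity ((1 + conj B) * (1 + d) - (1 + B) * (1 + conj d)
    - ((0 + conj B) * (0 + d) - (0 + B) * (0 + conj d))); first by ring.
  by rewrite E1 E0; ring.
have : (B - d) * (d - conj d) = 0.
  transitivity ((0 + conj B) * (0 + d) - (0 + B) * (0 + conj d)).
    by rewrite EB; ring.
  by rewrite E0 subrr.
by move/eqP; rewrite mulf_eq0 (negPf e0) orbF subr_eq0 => /eqP.
Qed.

Lemma fiberwise_affine_injectiveP :
  injective fiberwise_affine <->
  (g = 0 \/ g = - (B - conj B) ^+ 2) /\ d - B = 0 /\ B - conj B != 0.
Proof.
have shiftE : B = d -> fiberwise_affine =1 (fun x => x + a + g / (x + conj x + d)).
  move=> EB x; rewrite /fiberwise_affine EB.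
  have tr0 : x + conj x + d != 0 by rewrite fixed_addr_neq0 ?conj_trace.
  by field.
split=> [inj | [gE [/eqP]]].
  have EB := fiberwise_affine_pole inj.
  rewrite EB subrr; split; last by rewrite subr_conj_neq0.
  apply: trace_map_injective_necessary => //.
  apply/(injective_pole_perturbation d g a) => x y.
  by rewrite -!(shiftE EB); apply: inj.
rewrite subr_eq0 => /eqP/esym EB _.
suff /(injective_pole_perturbation d g a) inj : fixed_injective (trace_map d g).
  by move=> x y; rewrite !(shiftE EB); apply: inj.
by apply: trace_map_injective_sufficient => //; rewrite -EB.
Qed.

End Directions.
End QuadraticExtension.

(** * The degree-[q + 1] rational function *)

Lemma exists_Frobenius_power (F : finFieldType) p k :
  p \in [pchar F] -> exists s : {rmorphism F -> F}, forall x, s x = x ^+ (p ^ k).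
Proof.
move=> charFp; elim: k => [|k [s sE]]; first by exists idfun => x; rewrite expr1.
exists (pFrobenius_aut charFp \o s) => x.
by rewrite /= pFrobenius_autE sE -exprM expnSr.
Qed.

Theorem theorem5 (q : nat) (hq : exists p k : nat, prime p /\ (0 < k)%N /\ q = (p ^ k)%N)
    (hodd : odd q)
    (Fq F : finFieldType) (hFq : #|Fq| = q) (hF : #|F| = (q ^ 2)%N)
    (iota : {rmorphism Fq -> F})
    (a b c d : F) (hd : d \notin codom iota) :
  let gamma := a ^+ 2 - a * b + c in
  let delta := a - b + d in
  let eps := a ^+ q - a - b ^+ q + b in
  permutation_ratfun
    (tofrac ('X^(q.+1) + 'X^2 + a *: 'X^q + b *: 'X + c%:P)
     / tofrac ('X^q + 'X + d%:P))
  <-> (gamma = 0 \/ gamma = - eps ^+ 2) /\ delta = 0 /\ eps != 0.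
Proof.
move=> gamma delta eps.
have [s sE] : exists s : {rmorphism F -> F}, forall x, s x = x ^+ #|Fq|.
  have [p [k [p_pr [_ qE]]]] := hq.
  rewrite hFq qE; apply: exists_Frobenius_power.
  by apply: (card_finPcharP (n := k * 2)) => //; rewrite hF qE -expnM.
have cardF : #|F| = (#|Fq| ^ 2)%N by rewrite hFq.
have oddFq : odd #|Fq| by rewrite hFq.
have q_gt1 : (1 < q)%N by rewrite -hFq card_finNzRing_gt1.
have d_notin : s d != d by apply: contra hd => /eqP/(conj_fixedP iota sE).
have sqE x : x ^+ q = s x by rewrite sE hFq.
have DE x : ('X^q + 'X + d%:P).[x] = x + s x + d by rewrite !hornerE sqE (addrC x).
have NE x : ('X^(q.+1) + 'X^2 + a *: 'X^q + b *: 'X + c%:P).[x]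
    = (x + a) * (x + s x + (b - a)) + gamma.
  transitivity (x ^+ q.+1 + x ^+ 2 + a * x ^+ q + b * x + c); first by rewrite !hornerE.
  by rewrite exprSr sqE /gamma; ring.
have epsE : eps = (b - a) - s (b - a).
  by rewrite /eps !sqE rmorphB; ring.
have deltaE : delta = d - (b - a) by rewrite /delta; ring.
have D_nz x : ('X^q + 'X + d%:P).[x] != 0.
  by rewrite DE (fixed_addr_neq0 d_notin) // (conj_trace cardF sE).
have size_D : size ('X^q + 'X + d%:P)%R = q.+1.
  by rewrite -addrA size_polyDl size_polyXn // size_XaddC.
have size_N : size ('X^(q.+1) + 'X^2 + a *: 'X^q + b *: 'X + c%:P)%R = q.+2.
  rewrite -!addrA size_polyDl size_polyXn // ltnS.
  have sizeD (u v : {poly F}) :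
      (size u <= q.+1 -> size v <= q.+1 -> size (u + v)%R <= q.+1)%N.
    by move=> su sv; rewrite (leq_trans (size_polyD _ _)) // geq_max su.
  apply: (sizeD); [|apply: (sizeD); [|apply: (sizeD)]].
  - by rewrite size_polyXn.
  - by rewrite (leq_trans (size_scale_leq _ _)) ?size_polyXn.
  - by rewrite (leq_trans (size_scale_leq _ _)) ?size_polyX // ltnW.
  - by rewrite (leq_trans (size_polyC_leq1 _)).
rewrite (permutation_ratfunP D_nz) ?size_D ?size_N // deltaE epsE.
rewrite -(fiberwise_affine_injectiveP iota cardF sE oddFq a _ _ d_notin).
split=> inj x y; have := inj x y; rewrite /fiberwise_affine !NE !DE //.
Qed.
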